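(* Let $G$ be a finite group such that $\lambda(G)>\frac{1}{2}$. Then $G$ is abelian.
   Context: For a permutation $\psi$ of a finite set $X$, $\Lambda(\psi)$ denotes the largest length of a cycle in the disjoint cycle decomposition of $\psi$ (fixed points count as cycles of length $1$), and $\lambda(\psi):=\frac{1}{|X|}\Lambda(\psi)$. For a finite group $G$, $\Lambda(G):=\max_{\alpha\in\mathrm{Aut}(G)}\Lambda(\alpha)$ and $\lambda(G):=\frac{1}{|G|}\Lambda(G)$, where automorphisms are viewed as permutations of $G$. *)

(* Defs.v *)
From mathcomp Require Import all_boot all_order all_algebra all_fingroup.

Set Implicit Arguments.
Unset Strict Implicit.
Unset Printing Implicit Defensive.

Import Order.TTheory GRing.Theory Num.Theory.

(* A permutation of a finite set X is represented, as for the elements of       *)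
(* [Aut G], by psi : {perm T} with perm_on X psi; its cycles are then the       *)
(* orbits of the points of X, which lie within X (fixed points of psi in X      *)
(* give cycles of length 1).                                                    *)
Definition max_cycle_length (T : finType) (X : {set T}) (psi : {perm T}) : nat :=
  \max_(C in [set porbit psi x | x in X]) #|C|.

Definition max_aut_cycle_length (gT : finGroupType) (G : {group gT}) : nat :=
  \max_(alpha in Aut G) max_cycle_length G alpha.

Definition max_aut_cycle_ratio (gT : finGroupType) (G : {group gT}) : rat :=
  ((max_aut_cycle_length G)%:R / #|G|%:R)%R.

(* Main.v *)
Require Import Defs.
From mathcomp Require Import all_boot all_order all_algebra all_fingroup.
From mathcomp Require Import all_solvable zify.

Set Implicit Arguments.
Unset Strict Implicit.
Unset Printing Implicit Defensive.

Import Order.TTheory GRing.Theory Num.Theory.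
Local Open Scope group_scope.

(* Let O be the orbit of x under an automorphism a of G, with |O| > |G|/2. As
   O meets O^-1, some power b of a inverts all of O. If N is characteristic in
   G then each coset yN, with y in O, has more than half of its elements in O,
   so that n |-> b(n)^y inverts more than half of N. Modulo N' both this map
   and inversion are morphisms, hence they agree on N: all y in O act in the
   same way on N/N', whence [N, G] <= N'. For N = G' and N = G'' the three
   subgroups lemma gives G'' = G'''. A perfect group in which a morphism
   inverts more than half of the elements is trivial, by counting commuting
   pairs: its noncentral elements have at least 4 conjugates. Hence G'' = 1,
   and [G', G] = 1. In class 2, the powers of a that stabilise xG' are powers
   of some e, with e(x) = xu, u in G' and u^2 = 1, so |G'| < 4; if u != 1 then
   G' = {1, u}, e(y) = yu for all y in O, and yz^-1 is fixed by e for all y, z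
   in O, so that e = 1, a contradiction. So u = 1 and |G'| < 2. *)

(** * Subgroups of small index in perfect groups *)

Lemma perfect_normal_prime_index (gT : finGroupType) (P K : {group gT}) :
  P^`(1) = P -> K <| P -> ~~ prime #|P : K|.
Proof.
move=> perfP /andP[sKP nKP]; apply/negP => pr.
have cycPK : cyclic (P / K) by apply: prime_cyclic; rewrite card_quotient.
have := der1_min nKP (cyclic_abelian cycPK); rewrite perfP => sPK.
by move: pr; rewrite (eqP (_ : #|P : K| == 1%N)) // indexg_eq1.
Qed.

Lemma perfect_index_neq2 (gT : finGroupType) (P H : {group gT}) :
  P^`(1) = P -> H \subset P -> #|P : H| != 2.
Proof.
move=> perfP sHP; apply/eqP => iPH.
by have := perfect_normal_prime_index perfP (index2_normal sHP iPH);
  rewrite iPH.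
Qed.

(** A subgroup of order 3, given by Cauchy's theorem, would have index 2. *)
Lemma perfect_card_neq6 (gT : finGroupType) (Q : {group gT}) :
  Q^`(1) = Q -> #|Q| != 6.
Proof.
move=> perfQ; apply/eqP => oQ.
have [|x Qx ox] := @Cauchy _ 3 Q isT; first by rewrite oQ.
have sxQ : <[x]> \subset Q by rewrite cycle_subG.
have := perfect_index_neq2 perfQ sxQ.
by rewrite -divgS //= -orderE ox oQ.
Qed.

(** With [K] the core of [H], the action on the three cosets embeds [P / K] in a symmetric group of
    order 6, so [P / K] has order 3 or 6; both are impossible. *)
Lemma perfect_index_neq3 (gT : finGroupType) (P H : {group gT}) :
  P^`(1) = P -> H \subset P -> #|P : H| != 3.
Proof.
move=> perfP sHP; apply/eqP => iPH.
pose K := gcore H P.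
have sKH : K \subset H := gcore_sub H P.
have nKP : P \subset 'N(K) := gcore_norm H P.
have nsKP : K <| P by rewrite /normal (subset_trans sKH sHP).
have iPK : #|P : K| = (3 * #|H : K|)%N by rewrite -iPH Lagrange_index.
have leK : #|P : K| <= 6.
  have actP := actsRs_rcosets H P.
  pose f := actperm <[actP]>.
  have -> : #|P : K| = #|f @* P|.
    rewrite card_morphim setIid ker_actperm astab_actby setIT.
    by rewrite astabRs_rcosets (setIidPr _) // (subset_trans sKH sHP).
  apply: leq_trans (_ : #|perm_on (rcosets H P)| <= 6); last first.
    by rewrite card_perm -/(indexg P H) iPH.
  apply/subset_leq_card/subsetP => _ /morphimP[a _ Pa ->].
  rewrite unfold_in; apply/subsetP => C; rewrite !inE /f.
  by rewrite actpermE /= /actby; case: ifP => [/andP[]|_]; rewrite ?eqxx.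
have perfPK : (P / K)^`(1) = P / K by rewrite -quotient_der // perfP.
have nK1 : #|H : K| != 1%N.
  apply/eqP => e; have := perfect_normal_prime_index perfP nsKP.
  by rewrite iPK e.
have := perfect_card_neq6 perfPK; rewrite card_quotient // iPK.
move: leK nK1 (indexg_gt0 H K); rewrite iPK.
by case: #|H : K| => [|[|[|i]]] //; rewrite !mulnS.
Qed.

(** * Morphisms inverting more than half of a perfect group *)

(** Double counting: for a fixed [t], the [g] with [g * t] in [A] form the translate of [A] by
    [t^-1]. *)
Lemma sum_card_translates (gT : finGroupType) (P : {group gT})
    (A B : {set gT}) :
  A \subset P -> B \subset P ->
  \sum_(g in P) #|[set t in B | (g * t)%g \in A]| = (#|A| * #|B|)%N.
Proof.
move=> sAP sBP.
transitivity (\sum_(g in P) \sum_(t in B) ((g * t)%g \in A : nat)).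
  apply: eq_bigr => g _; rewrite -sum1_card big_mkcond.
  rewrite [RHS]big_mkcond /=; apply: eq_bigr => t _; rewrite !inE.
  by case: (t \in B); case: (_ \in A).
rewrite exchange_big /= mulnC -sum_nat_const; apply: eq_bigr => t Bt.
have Pt := subsetP sBP t Bt.
rewrite -(card_rcoset A t^-1) -sum1_card big_mkcond [RHS]big_mkcond /=.
apply: eq_bigr => g _; rewrite mem_rcoset invgK.
case: (boolP (g * t \in A)) => [Agt | _]; last by case: (g \in P).
by rewrite -(groupMr g Pt) (subsetP sAP).
Qed.

(** Count the pairs [(g, t)] with [t] and [g * t] both inverted. A noncentral [g] occurs in at most
    [#|P| / 4] of them, a central [g] only if it is inverted itself; the majority then forces [P] to
    be central. *)
Lemma majority_perfect_trivial (gT : finGroupType) (P : {group gT})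
    (s : gT -> gT) :
  P^`(1) = P -> {in P &, {morph s : a b / a * b}} ->
  #|P| < 2 * #|[set g in P | s g == g^-1]| -> P :=: 1.
Proof.
move=> perfP sM; set T := [set g in P | _] => majT.
have TP g : reflect (g \in P /\ s g = g^-1) (g \in T).
  by rewrite inE; apply: (iffP andP) => [][Pg /eqP].
have sTP : T \subset P by apply/subsetP => g /TP[].
pose I g := [set t in T | g * t \in T].
(* If t and gt are inverted by s, then t conjugates g^-1 to s(g): such t lie in
   a single coset of the centralizer of g. *)
have I_conj g t : g \in P -> t \in I g -> s g = (g^-1) ^ t.
  move=> Pg; rewrite inE => /andP[/TP[Pt st] /TP[_]].
  rewrite sM // st => /(canRL (mulgK _)) ->.
  by rewrite invgK invMg /conjg !mulgA.
have leI g : g \in P -> #|I g| <= #|'C_P[g]|.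
  move=> Pg; have [->|[t It]] := set_0Vmem (I g); first by rewrite cards0.
  have Pt : t \in P by move: It; rewrite inE => /andP[/TP[]].
  rewrite -(card_rcoset 'C_P[g] t); apply/subset_leq_card/subsetP => u Iu.
  have Pu : u \in P by move: Iu; rewrite inE => /andP[/TP[]].
  rewrite mem_rcoset inE groupM ?groupV //=.
  apply/cent1P/commute_sym/commgP/conjg_fixP.
  have := I_conj g t Pg It; rewrite (I_conj g u Pg Iu) !conjVg => /invg_inj e.
  by rewrite conjgM e conjgK.
pose Z := 'Z(P); pose Z0 := Z :&: T.
have ZP z : z \in Z -> z \in P /\ forall g, g \in P -> commute z g.
  by move=> /setIP[Pz /centP cz]; split=> // g /cz.
have gZ0 : group_set Z0.
  apply/group_setP; split=> [|y z].
    rewrite inE group1; apply/TP; split=> //.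
    by apply: (mulgI (s 1)); rewrite -sM // invg1 !mulg1.
  move=> /setIP[Zy /TP[Py sy]] /setIP[Zz /TP[Pz sz]].
  rewrite inE groupM //; apply/TP; split; first exact: groupM.
  rewrite sM // sy sz -invMg; congr (_^-1).
  by have [_ ->] := ZP _ Zz.
pose H := Group gZ0.
have sHP : H \subset P by apply/subsetP => z /setIP[/ZP[]].
have sZH : #|H| <= #|Z| by apply/subset_leq_card/subsetIl.
have dvdT : #|H| %| #|T|.
  have actT : [acts H, on T | 'R].
    apply/actsP => z Hz; have [/ZP[Pz Zz] /TP[_ sz]] := setIP Hz.
    have sTz t u : u \in P -> s u = u^-1 -> t \in T -> commute u t ->
        t * u \in T.
      move=> Pu su /TP[Pt st] cut; apply/TP; split; first exact: groupM.
      by rewrite sM // st su -invMg cut.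
    move=> t /=; apply/idP/idP => [Ttz | Tt]; last first.
      exact: sTz (Zz t (subsetP sTP t Tt)).
    have Pt : t \in P by rewrite -(groupMr t Pz) (subsetP sTP).
    have /setIP[_ /TP[Pz' sz']] : z^-1 \in H by rewrite groupV.
    rewrite -(mulgK z t); apply: sTz => //; apply/commute_sym/commuteV.
    by apply/commute_sym/commuteM; [apply: Zz | apply: commute_refl].
  rewrite (@card_uniform_partition _ #|H| _ _ _ (orbit_partition actT)).
    by rewrite dvdn_mull.
  by move=> _ /imsetP[t _ ->]; rewrite orbitR card_lcoset.
have dvdP : #|H| %| #|P| by apply: cardSg.
(* T is a union of cosets of H, which sharpens the majority hypothesis just
   enough for the count below to be contradictory. *)
have leT : #|P| + #|H| <= 2 * #|T|.
  move: majT; case/dvdnP: dvdT => a ->; case/dvdnP: dvdP => b ->.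
  by rewrite mulnA ltn_pmul2r ?cardG_gt0 // -mulSnr leq_pmul2r ?cardG_gt0.
(* The centralizer of [g] has index other than 1 as [g] is not central, and other than 2 and 3 as
   [P] is perfect. *)
have index_ge4 g : g \in P :\: Z -> 4 * #|I g| <= #|P|.
  case/setDP => Pg nZg; rewrite -(Lagrange (subsetIl P 'C[g])) mulnC.
  apply: leq_mul; first exact: leI.
  have sCP := subsetIl P 'C[g].
  have := perfect_index_neq2 perfP sCP; have := perfect_index_neq3 perfP sCP.
  have := indexg_gt0 P 'C_P[g].
  have : #|P : 'C_P[g]| != 1%N.
    apply: contra nZg; rewrite indexg_eq1 => sPC; rewrite inE Pg.
    by apply/centP => h /(subsetP sPC)/setIP[_ /cent1P].
  by case: #|_ : _| => [|[|[|[|i]]]].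
have I_Z g : g \in Z -> #|I g| <= (g \in H) * #|T|.
  move=> Zg; have [Pg cg] := ZP g Zg.
  have [->|[t It]] := set_0Vmem (I g); first by rewrite cards0.
  have Pt : t \in P by move: It; rewrite inE => /andP[/TP[]].
  have Hg : g \in H.
    apply/setIP; split=> //; apply/TP; split=> //.
    by rewrite (I_conj g t) // conjVg /conjg (cg t) // mulKg.
  rewrite Hg mul1n; apply/subset_leq_card/subsetP => u.
  by rewrite inE => /andP[].
have sumI := sum_card_translates sTP sTP.
have sZP : Z \subset P by apply: subsetIl.
rewrite (big_setID Z) /= (setIidPr sZP) in sumI.
have sum1 : \sum_(g in Z) #|I g| <= #|H| * #|T|.
  apply: leq_trans (_ : \sum_(g in Z) (g \in H) * #|T| <= _).
    by apply: leq_sum => g; apply: I_Z.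
  rewrite -big_distrl leq_mul2r /=; apply/orP; right.
  rewrite -sum1_card big_mkcond [X in _ <= X]big_mkcond; apply: leq_sum => g _.
  by case: ifP; case: ifP.
have sum2 : 4 * \sum_(g in P :\: Z) #|I g| <= (#|P| - #|Z|) * #|P|.
  rewrite big_distrr /= -(cardsDS sZP) -sum_nat_const.
  by apply: leq_sum => g; apply: index_ge4.
have lePH : #|P| <= #|H|.
  have : #|Z| <= #|P| by apply: subset_leq_card.
  move: sumI sum1 sum2 sZH leT (cardG_gt0 H).
  move: (\sum_(g in Z) _) (\sum_(g in P :\: Z) _) => S1 S2.
  move: #|P| #|H| #|T| #|Z| => n h t z eS leS1 leS2 lehz leT h_gt0 lezn.
  have [d def_t] : exists d, (2 * t)%N = n + h + d.
    by exists (2 * t - (n + h))%N; lia.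
  have le_zn : h * n <= z * n by rewrite leq_mul2r lehz orbT.
  have : ((2 * t) * (2 * t) + h * n <= 2 * h * (2 * t) + n * n)%N.
    move: leS2; rewrite mulnBl.
    have : z * n <= n * n by rewrite leq_mul2r lezn orbT.
    lia.
  (* Expanding leaves [d * d + 2 * n * d + h * n <= h * h]. *)
  rewrite def_t => {eS leS1 leS2 le_zn} le_sq.
  have : h * n <= h * h by nia.
  by rewrite leq_pmul2l.
have sPZ : P \subset Z.
  have /eqP <- : H == P :> {set gT} by rewrite eqEcard sHP.
  exact: subsetIl.
rewrite -perfP; apply/commG1P.
by apply: subset_trans sPZ _; apply: subsetIr.
Qed.

(** * Majority subsets and large orbits of automorphisms *)

(** [A] lies in a single coset of [G :&: H], which thus has index less than 2 in [G]. *)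
Lemma majority_sub (gT : finGroupType) (G H : {group gT}) (A : {set gT}) :
  A \subset G -> #|G| < 2 * #|A| ->
  {in A &, forall y z, y * z^-1 \in H} -> G \subset H.
Proof.
move=> sAG majA AH.
have [A0|[z Az]] := set_0Vmem A; first by rewrite A0 cards0 muln0 in majA.
have leA : #|A| <= #|G :&: H|.
  rewrite -(card_rcoset (G :&: H) z); apply/subset_leq_card/subsetP => y Ay.
  by rewrite mem_rcoset inE AH // groupM ?groupV ?(subsetP sAG).
have : #|G : G :&: H| < 2.
  rewrite -(ltn_pmul2l (cardG_gt0 (G :&: H))) Lagrange ?subsetIl // mulnC.
  by apply: leq_trans majA _; rewrite leq_mul2l.
have := indexg_gt0 G (G :&: H).
case i1: #|_ : _| => [|[|i]] // _ _.
by move/eqP: i1; rewrite indexg_eq1 subsetI => /andP[].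
Qed.

Lemma AutM (gT : finGroupType) (G : {group gT}) a :
  a \in Aut G -> {in G &, {morph a : y z / y * z}}.
Proof. by move=> Aa; apply/morphicP/Aut_morphic. Qed.

Lemma AutV (gT : finGroupType) (G : {group gT}) a :
  a \in Aut G -> {in G, {morph a : y / y^-1}}.
Proof. by move=> Aa y Gy; rewrite -(autmE Aa) morphV. Qed.

Lemma Aut_char_im (gT : finGroupType) (G N : {group gT}) a :
  a \in Aut G -> N \char G -> [set a n | n in N] = N.
Proof.
move=> Aa /charP[sNG /(_ (autm_morphism Aa) (injm_autm Aa) (im_autm Aa)) aN].
by rewrite -[RHS]aN /= morphimEsub //; apply: eq_imset => n; rewrite /= autmE.
Qed.

Lemma Aut_char_mem (gT : finGroupType) (G N : {group gT}) a n :
  a \in Aut G -> N \char G -> n \in N -> a n \in N.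
Proof. by move=> Aa chN Nn; rewrite -(Aut_char_im Aa chN) imset_f. Qed.

Lemma Aut_cycle_mem (gT : finGroupType) (G : {group gT}) a b :
  a \in Aut G -> b \in <[a]> -> b \in Aut G.
Proof. by move=> Aa; apply/subsetP; rewrite cycle_subG. Qed.

Lemma porbit_cycleP (T : finType) (a : {perm T}) x y :
  reflect (exists2 b, b \in <[a]> & y = b x) (y \in porbit a x).
Proof.
apply: (iffP (porbitP a x y)) => [[i ->]|[_ /cycleP[i ->] ->]].
  by exists (a ^+ i); rewrite ?mem_cycle.
by exists i.
Qed.

Lemma porbit_Aut_sub (gT : finGroupType) (G : {group gT}) a x :
  a \in Aut G -> x \in G -> porbit a x \subset G.
Proof.
move=> Aa Gx; apply/subsetP => _ /porbit_cycleP[b ab ->].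
exact: (Aut_closed (Aut_cycle_mem Aa ab)).
Qed.

(** Powers of [a] commute: if [b y = y^-1] for one [y] in the orbit, then
    [b (c y) = c (b y) = (c y)^-1] for every power [c] of [a]. *)
Lemma majority_porbit_inverted (gT : finGroupType) (G : {group gT}) a x :
  a \in Aut G -> x \in G -> #|G| < 2 * #|porbit a x| ->
  exists2 b, b \in <[a]> & {in porbit a x, forall y, b y = y^-1}.
Proof.
move=> Aa Gx majO; have sOG := porbit_Aut_sub Aa Gx.
have [y /setIP[Oy]] : exists y, y \in porbit a x :&: (porbit a x)^-1.
  apply/set0Pn; rewrite -card_gt0.
  rewrite -(ltn_add2l #|porbit a x :|: (porbit a x)^-1|).
  rewrite cardsUI addn0 card_invg addnn -mul2n; apply: leq_ltn_trans majO.
  by apply: subset_leq_card; rewrite subUset sOG -invSg invGid invgK.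
rewrite -(eqP (_ : porbit a y == porbit a x)) ?eq_porbit_mem //.
rewrite inE => /porbit_cycleP[b ab yV]; exists b => //.
move=> _ /porbit_cycleP[c ac ->].
have Gy := subsetP sOG y Oy.
rewrite -(AutV (Aut_cycle_mem Aa ac)) // yV -!permM.
by rewrite (centsP (cycle_abelian a) _ ab _ ac).
Qed.

(** Powers of [a] permute the cosets of [N], so no coset meets the orbit in more points than
    [x *: N] does; averaging over the cosets gives the bound. *)
Lemma majority_porbit_coset (gT : finGroupType) (G N : {group gT}) a x :
  a \in Aut G -> x \in G -> #|G| < 2 * #|porbit a x| -> N \char G ->
  #|N| < 2 * #|[set n in N | x * n \in porbit a x]|.
Proof.
move=> Aa Gx majO chN; have sOG := porbit_Aut_sub Aa Gx.
have sNG := char_sub chN; set O := porbit a x.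
pose k := #|[set n in N | x * n \in O]|.
have le_k g : g \in G -> #|[set n in N | (g * n)%g \in O]| <= k.
  move=> Gg; have [->|[m]] := set_0Vmem [set n in N | (g * n)%g \in O].
    by rewrite cards0.
  rewrite inE => /andP[Nm /porbit_cycleP[b ab gm]].
  have aV : b^-1 \in <[a]> by rewrite groupV.
  have Ab := Aut_cycle_mem Aa aV.
  (* Chosen so that [x * f n = b^-1 (g * n)]. *)
  pose f n := b^-1 (m^-1 * n).
  have f_inj : injective f by move=> n n' /perm_inj/mulgI.
  rewrite -(card_imset _ f_inj).
  apply/subset_leq_card/subsetP => _ /imsetP[n + ->].
  rewrite !inE => /andP[Nn Ogn].
  have Nmn : m^-1 * n \in N by rewrite groupM ?groupV.
  rewrite (Aut_char_mem Ab chN) //= /f.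
  have -> : x = b^-1 (g * m) by rewrite gm permK.
  rewrite -(AutM Ab (groupM Gg (subsetP sNG _ Nm)) (subsetP sNG _ Nmn)).
  rewrite -mulgA mulKVg.
  case/porbit_cycleP: Ogn => c ac ->; apply/porbit_cycleP.
  by exists (c * b^-1); rewrite ?groupM ?permM.
have sumO := sum_card_translates sOG sNG.
have : #|O| * #|N| <= #|G| * k.
  by rewrite -sumO -sum_nat_const; apply: leq_sum.
have O_gt0 : 0 < #|O|.
  by rewrite card_gt0; apply/set0Pn; exists x; apply: porbit_id.
rewrite -(ltn_pmul2l O_gt0) => leON; apply: leq_ltn_trans leON _.
rewrite mulnA (mulnC #|O|) ltn_pmul2r //.
(* Strictness requires [k] to be positive; [1] is counted because [x] is in its own orbit. *)
by rewrite card_gt0; apply/set0Pn; exists 1; rewrite inE group1 mulg1 porbit_id.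
Qed.

(** * Commutators with characteristic subgroups *)

Lemma majority_porbit_char_central (gT : finGroupType) (G N : {group gT}) a x :
  a \in Aut G -> x \in G -> #|G| < 2 * #|porbit a x| -> N \char G ->
  [~: N, G] \subset N^`(1).
Proof.
move=> Aa Gx majO chN; have sOG := porbit_Aut_sub Aa Gx.
have [b ab bV] := majority_porbit_inverted Aa Gx majO.
have Ab := Aut_cycle_mem Aa ab.
have sNG := char_sub chN; have nNG := char_norm chN.
have nN'G : G \subset 'N(N^`(1)) := char_norm (char_trans (der_char 1 N) chN).
have nN'N : N \subset 'N(N^`(1)) := subset_trans sNG nN'G.
have abN : abelian (N / N^`(1)) by apply: sub_der1_abelian.
have Nb n : n \in N -> b n \in N by move=> Nn; apply: (Aut_char_mem Ab chN).
have act_O y n : y \in porbit a x -> n \in N ->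
    coset N^`(1) (b n ^ y) = (coset N^`(1) n)^-1.
  move=> Oy Nn; have Gy := subsetP sOG y Oy.
  have Oyx : porbit a y = porbit a x by apply/eqP; rewrite eq_porbit_mem.
  have NbJ m : m \in N -> b m ^ y \in N.
    by move=> Nm; rewrite memJ_norm ?Nb ?(subsetP nNG).
  have imN m : m \in N -> coset N^`(1) m \in N / N^`(1) by apply: mem_quotient.
  have cosetM : {in N &, {morph coset N^`(1) : u v / u * v}}.
    by move=> u v Nu Nv; rewrite morphM ?(subsetP nN'N).
  pose S := [set m in N | coset N^`(1) (b m ^ y) == (coset N^`(1) m)^-1].
  have gS : group_set S.
    apply/group_setP; split=> [|m1 m2].
      by rewrite inE group1 -(autmE Ab) morph1 conj1g morph1 invg1 eqxx.
    rewrite !inE => /andP[Nm1 /eqP e1] /andP[Nm2 /eqP e2]; rewrite groupM //.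
    rewrite (AutM Ab) ?(subsetP sNG) // conjMg.
    rewrite (cosetM (b m1 ^ y)) ?NbJ // (cosetM m1) // e1 e2 -invMg.
    by rewrite (centsP abN _ (imN _ Nm2) _ (imN _ Nm1)) eqxx.
  suff /subsetP/(_ n Nn) : N \subset Group gS by rewrite inE => /andP[_ /eqP].
  pose D := [set m in N | y * m \in porbit a y].
  have sDN : D \subset N by apply/subsetP => m; rewrite inE => /andP[].
  apply: (@majority_sub _ _ _ D) => //.
    by apply: (majority_porbit_coset Aa Gy _ chN); rewrite Oyx.
  move=> m1 m2 Dm1 Dm2; suff sDS : {subset D <= Group gS}.
    by rewrite groupM ?groupV ?sDS.
  (* Since [b] inverts [y] and [y * m], [y^-1 * b m = m^-1 * y^-1], that is [b m ^ y = m^-1]. *)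
  move=> m; rewrite !inE Oyx => /andP[Nm /bV bym]; rewrite Nm /=; apply/eqP.
  rewrite -morphV ?(subsetP nN'N) //; congr (coset _ _).
  have Gm := subsetP sNG m Nm.
  move: bym; rewrite (AutM Ab) // bV // invMg => /(canRL (mulKVg _)) ->.
  by rewrite conjgE !mulgA mulVg mul1g mulgKV.
have : G \subset coset N^`(1) @*^-1 'C(N / N^`(1)).
  apply: (@majority_sub _ _ _ (porbit a x)) => // y z Oy Oz.
  have Gy := subsetP sOG y Oy; have Gz := subsetP sOG z Oz.
  have [nNy nNz] := (subsetP nN'G y Gy, subsetP nN'G z Gz).
  apply/morphpreP; split; first by rewrite groupM ?groupV.
  apply/centP => _ /morphimP[m nNm Nm ->].
  (* As [b] maps [N] onto [N], agreement of [y] and [z] on the images [b n] is agreement on all of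
     [N]. *)
  have := Nm; rewrite -{1}(Aut_char_im Ab chN) => /imsetP[n Nn def_m].
  have nNn : n \in 'N(N^`(1)) by apply: (subsetP nN'N).
  have := act_O y n Oy Nn; rewrite -(act_O z n Oz Nn) -def_m.
  rewrite !morphJ // => e; apply/commute_sym/commgP/conjg_fixP.
  by rewrite morphM ?groupV // morphV //= conjgM e conjgK.
by rewrite -sub_quotient_pre // centsC quotient_cents2.
Qed.

Lemma der2_perfect_of_central (gT : finGroupType) (G : {group gT}) :
  [~: G^`(1), G] \subset G^`(2) -> [~: G^`(2), G] \subset G^`(3) ->
  G^`(3) = G^`(2).
Proof.
move=> sG1G2 sG2G3; apply/eqP; rewrite eqEsubset der_subS /=.
have nK : G \subset 'N(G^`(3)) := der_norm 3 G.
have nKd n : G^`(n) \subset 'N(G^`(3)) by apply: subset_trans (der_sub n G) nK.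
have c1 : [~: G^`(1) / G^`(3), G / G^`(3), G / G^`(3)] = 1.
  have nKG1G : [~: G^`(1), G] \subset 'N(G^`(3)) by rewrite comm_subG.
  rewrite -!quotientR //; apply/trivgP.
  rewrite quotient_sub1; last by rewrite comm_subG.
  by apply: subset_trans sG2G3; rewrite commSg.
have c2 : [~: G / G^`(3), G^`(1) / G^`(3), G / G^`(3)] = 1.
  by rewrite [[~: G / _, _]]commGC.
have /commG1P := three_subgroup c2 c1.
by rewrite -quotientR // quotient_cents2 // (nKd 1%N).
Qed.

(** * Groups with central derived subgroup *)

Lemma Aut_fix_group_set (gT : finGroupType) (G : {group gT}) a :
  a \in Aut G -> group_set [set g in G | a g == g].
Proof.
move=> Aa; apply/group_setP; split=> [|g h].
  by rewrite inE group1 -(autmE Aa) morph1 eqxx.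
rewrite !inE => /andP[Gg /eqP ag] /andP[Gh /eqP ah].
by rewrite groupM // (AutM Aa) // ag ah eqxx.
Qed.

Lemma class2_Aut_fix_der1 (gT : finGroupType) (G : {group gT})
    (A : {set gT}) c :
  [~: G^`(1), G] = 1 -> c \in Aut G ->
  A \subset G -> #|G| < 2 * #|A| ->
  {in A &, forall y z, [~ c y, c z] = [~ y, z]} ->
  {in G^`(1), forall n, c n = n}.
Proof.
move=> /commG1P/centsP cG1 Ac sAG majA cA.
pose F := Group (Aut_fix_group_set Ac).
have FP g : reflect (g \in G /\ c g = g) (g \in F).
  by rewrite inE; apply: (iffP andP) => [][Gg /eqP].
have comG g h : g \in G -> h \in G -> [~ g, h] \in G^`(1) by apply: mem_commg.
have comF g h : g \in A -> h \in A -> [~ g, h] \in F.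
  move=> Ag Ah; have [Gg Gh] := (subsetP sAG g Ag, subsetP sAG h Ah).
  apply/FP; split; first exact: groupR.
  by rewrite -(autmE Ac) morphR //= autmE cA.
(* The preimage of [F] under [f] is a subgroup containing the majority set [A]. *)
have extend (f : gT -> gT) : {in G &, forall g h, f (g * h) = f g * f h} ->
    {in A, forall g, f g \in F} -> {in G, forall g, f g \in F}.
  move=> fM fA g Gg; pose S := [set h in G | f h \in F].
  have gS : group_set S.
    apply/group_setP; split=> [|h k].
      apply/setIdP; split=> //; suff -> : f 1 = 1 by apply: group1.
      by apply: (mulgI (f 1)); rewrite -fM // !mulg1.
    move=> /setIdP[Gh Fh] /setIdP[Gk Fk]; apply/setIdP; split.
      exact: groupM.
    by rewrite fM // groupM.
  suff /subsetP/(_ g Gg) : G \subset Group gS by case/setIdP.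
  have sAS h : h \in A -> h \in Group gS.
    by move=> Ah; apply/setIdP; rewrite (subsetP sAG h Ah) fA.
  by apply: (majority_sub sAG majA) => h k Ah Ak; rewrite groupM ?groupV ?sAS.
have comJ g h k : g \in G -> h \in G -> k \in G -> [~ g, h] ^ k = [~ g, h].
  by move=> Gg Gh Gk; apply/conjg_fixP/commgP; apply: cG1; rewrite ?comG.
have comAG g h : g \in A -> h \in G -> [~ g, h] \in F.
  move=> Ag; have Gg := subsetP sAG g Ag.
  apply: (extend (fun h => [~ g, h])) => [h1 h2 Gh1 Gh2|h1]; last exact: comF.
  by rewrite /= commgMJ comJ // (cG1 _ (comG _ _ Gg Gh2)) ?groupR.
have sG1F : G^`(1) \subset F.
  rewrite gen_subG; apply/subsetP => _ /imset2P[g h Gg Gh ->].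
  apply: (extend (fun g => [~ g, h])) Gg => [g1 g2 Gg1 Gg2|g1 Ag1].
    by rewrite /= commMgJ comJ.
  exact: comAG.
by move=> n /(subsetP sG1F)/FP[].
Qed.

Lemma class2_majority_porbit_abelian (gT : finGroupType) (G : {group gT}) a x :
  a \in Aut G -> x \in G -> #|G| < 2 * #|porbit a x| ->
  [~: G^`(1), G] = 1 -> abelian G.
Proof.
move=> Aa Gx majO cl2; have sOG := porbit_Aut_sub Aa Gx.
have chN := der_char 1 G; set N := G^`(1)%G in chN.
have sNG : N \subset G := char_sub chN.
have /centsP cNG : N \subset 'C(G) by apply/commG1P.
have AutN c n : c \in <[a]> -> n \in N -> c n \in N.
  by move=> ac; apply: (Aut_char_mem (Aut_cycle_mem Aa ac) chN).
have majD := majority_porbit_coset Aa Gx majO chN.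
set D := [set n in N | _] in majD.
have sDN : D \subset N by apply/subsetP => n /setIdP[].
have comJ g h k : g \in G -> h \in G -> k \in G -> [~ g, h] ^ k = [~ g, h].
  by move=> Gg Gh Gk; apply/conjg_fixP/commgP; apply: cNG; rewrite ?mem_commg.
have [b ab bV] := majority_porbit_inverted Aa Gx majO.
have Ab := Aut_cycle_mem Aa ab.
(* In class 2, [[~ y^-1, z^-1] = [~ y, z]], so [b] preserves commutators of elements of the
   orbit. *)
have bN : {in N, forall n, b n = n}.
  apply: (class2_Aut_fix_der1 cl2 Ab sOG majO) => y z Oy Oz.
  have [Gy Gz] := (subsetP sOG y Oy, subsetP sOG z Oz).
  have comN g h : g \in G -> h \in G -> commute h [~ g, h].
    by move=> Gg Gh; apply/commute_sym/cNG; rewrite ?mem_commg.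
  rewrite !bV // commgV; last by apply: comN; rewrite ?groupV.
  rewrite commVg ?invgK //; apply/commute_sym/cNG => //.
  by rewrite mem_commg.
(* Computing [b (x * n)] in two ways gives [x^-1 * n = x^-1 * n^-1]. *)
have exp2 n : n \in D -> n * n = 1.
  case/setIdP=> Nn Oxn; have Gn := subsetP sNG n Nn; have := bV _ Oxn.
  rewrite (AutM Ab) // bV ?porbit_id // bN // invMg.
  rewrite (cNG n^-1 _ x^-1) ?groupV // => /mulgI def_n.
  by rewrite {2}def_n mulgV.
(* The stabilizer of the coset [x *: N] in [<[a]>]; as a subgroup of a cyclic group it has a
   generator [e]. *)
pose E := [set c in <[a]> | x^-1 * c x \in N].
have mulE c d y : c \in <[a]> -> d \in <[a]> -> y = d x ->
    c y = y * d (x^-1 * c x).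
  move=> ac ad ->; have Ad := Aut_cycle_mem Aa ad.
  rewrite -(AutM Ad) ?mulKVg -?permM; last 2 first.
  - exact: Gx.
  - by rewrite groupM ?groupV // (Aut_closed (Aut_cycle_mem Aa ac)).
  by rewrite (centsP (cycle_abelian a) _ ac _ ad).
(* Such a [c] multiplies each element of the orbit by a central element, which leaves commutators
   unchanged. *)
have fixN c : c \in E -> {in N, forall n, c n = n}.
  case/setIdP=> ac Nc; apply: (class2_Aut_fix_der1 cl2 _ sOG majO).
    exact: Aut_cycle_mem ac.
  move=> y z Oy Oz; have [Gy Gz] := (subsetP sOG y Oy, subsetP sOG z Oz).
  case/porbit_cycleP: Oy => d ad def_y; case/porbit_cycleP: Oz => f af def_z.
  rewrite (mulE c d y) // (mulE c f z) //.
  have Nd := AutN d _ ad Nc; have Nf := AutN f _ af Nc.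
  move: (d _) Nd (f _) Nf => m Nm m' Nm'.
  have [Gm Gm'] := (subsetP sNG m Nm, subsetP sNG m' Nm').
  have com1 g h : g \in N -> h \in G -> [~ g, h] = 1.
    by move=> Ng Gh; apply/eqP/commgP/cNG.
  rewrite commMgJ (com1 m) ?groupM // mulg1 comJ ?groupM //.
  by rewrite commgMJ comJ // -invgR (com1 m') // invg1 mul1g.
have gE : group_set E.
  apply/group_setP; split=> [|c d /setIdP[ac Nc] Ed].
    by apply/setIdP; rewrite group1 perm1 mulVg group1.
  have [ad Nd] := setIdP Ed; apply/setIdP; rewrite groupM //; split=> //.
  have Gcx : c x \in G by rewrite (Aut_closed (Aut_cycle_mem Aa ac)).
  rewrite permM -(mulKVg x (c x)).
  rewrite (AutM (Aut_cycle_mem Aa ad) Gx) ?(subsetP sNG) //.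
  by rewrite mulgA groupM // AutN.
have cycE : cyclic (Group gE).
  by apply: cyclicS (cycle_cyclic a); apply/subsetP => c /setIdP[].
have [e def_E] := cyclicP cycE.
have Ee : e \in E by rewrite [E]def_E cycle_id.
have [ae Nu] := setIdP Ee; set u := _ * _ in Nu.
have Ae := Aut_cycle_mem Aa ae.
have ex : e x = x * u by rewrite mulKVg.
have Gu := subsetP sNG u Nu.
have eXx k : (e ^+ k) x = x * u ^+ k.
  elim: k => [|k IHk]; first by rewrite perm1 mulg1.
  rewrite expgSr permM IHk (AutM Ae) ?groupX // ex (fixN e) ?groupX //.
  by rewrite -mulgA -expgS.
have Du : u \in D.
  by apply/setIdP; split=> //; rewrite -ex; apply/porbit_cycleP; exists e.
have uu : u ^+ 2 = 1 := exp2 u Du.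
(* If [x * n = c x] with [n] in [N], then [c] lies in [E], so [n] is a power of [u]. *)
have sDu : D \subset [set 1; u].
  apply/subsetP => n /setIdP[Nn /porbit_cycleP[c ac xn]].
  have : c \in <[e]> by rewrite -def_E; apply/setIdP; rewrite -xn mulKg.
  case/cycleP=> k def_c; move: xn; rewrite def_c eXx => /mulgI ->.
  by rewrite -(expg_mod k uu) modn2 !inE; case: odd; rewrite ?eqxx ?orbT.
have leD := subset_leq_card sDu; rewrite cards2 in leD.
have [u1|nt_u] := eqVneq u 1.
  rewrite u1 eqxx in leD; apply/derG1P/eqP; rewrite -/(gval N) trivg_card1.
  rewrite eqn_leq cardG_gt0 andbT -ltnS; apply: leq_trans majD _.
  by rewrite (leq_mul2l 2 _ 1).
have ou : #[u] = 2 by apply: nt_prime_order.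
(* Here [#|N|] is even, positive and less than 4. *)
have def_N : <[u]> = N.
  apply/eqP; rewrite eqEcard cycle_subG Nu -orderE ou.
  have : #|N| < 4.
    apply: leq_trans majD _; rewrite (leq_mul2l 2 _ 2) /= (leq_trans leD) //.
    by case: (1 != u).
  have := cardSg (_ : <[u]> \subset N).
  rewrite cycle_subG -orderE ou => /(_ Nu).
  by case: #|N| => [|[|[|[|m]]]].
have fix_u d : d \in <[a]> -> d u = u.
  move=> ad; have := AutN d u ad Nu; rewrite -def_N cycle2g // !inE.
  case/orP=> /eqP // du1; case/eqP: nt_u; apply: (@perm_inj _ d).
  by rewrite du1 -(autmE (Aut_cycle_mem Aa ad)) morph1.
have eO y : y \in porbit a x -> e y = y * u.
  by case/porbit_cycleP=> d ad def_y; rewrite (mulE e d) // fix_u.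
(* On the orbit [e] is multiplication by the central [u], which cancels in [y * z^-1]; so [e] would
   fix [x] as well. *)
have sGF : G \subset Group (Aut_fix_group_set Ae).
  apply: (majority_sub sOG majO) => y z Oy Oz.
  have [Gy Gz] := (subsetP sOG y Oy, subsetP sOG z Oz).
  apply/setIdP; rewrite groupM ?groupV // (AutM Ae) ?groupV // (AutV Ae) //.
  by rewrite !eO // invMg mulgA mulgK eqxx.
have /setIdP[_ /eqP] := subsetP sGF x Gx.
rewrite ex => /(canRL (mulKg x)); rewrite mulVg => /eqP.
by rewrite (negPf nt_u).
Qed.

(** * Reduction to class 2 and conclusion *)

Theorem theorem1p1p7 (gT : finGroupType) (G : {group gT}) :
  (1 / 2 < max_aut_cycle_ratio G)%R -> abelian G.
Proof.
apply: contraTT => nabG; rewrite -leNgt /max_aut_cycle_ratio.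
suff le2 : 2 * max_aut_cycle_length G <= #|G|.
  rewrite ler_pdivrMr ?ltr0n ?cardG_gt0 //.
  by rewrite mulrAC ler_pdivlMr ?ltr0n // mul1r mulrC -natrM ler_nat.
(* Halving the order puts the bound in the form needed to bound each term of the maximum. *)
suff le_half : max_aut_cycle_length G <= #|G|./2.
  by rewrite mul2n -geq_half_double.
apply/bigmax_leqP => a Aa; apply/bigmax_leqP => _ /imsetP[x Gx ->].
rewrite geq_half_double -mul2n leqNgt; apply: contra nabG => majO.
have cG n := majority_porbit_char_central Aa Gx majO (der_char n G).
have perf := der2_perfect_of_central (cG 1%N) (cG 2).
apply: (class2_majority_porbit_abelian Aa Gx majO).
have [b ab bV] := majority_porbit_inverted Aa Gx majO.
have Ab := Aut_cycle_mem Aa ab.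
have ch2 := der_char 2 G.
have sPG : G^`(2) \subset G := der_sub 2 G.
suff G2 : G^`(2) = 1 by apply/trivgP; rewrite -G2; apply: cG.
apply: (@majority_perfect_trivial _ _ (fun n => b n ^ x) perf).
  by move=> m n Pm Pn; rewrite /= (AutM Ab) ?(subsetP sPG) // conjMg.
apply: leq_trans (majority_porbit_coset Aa Gx majO ch2) _.
rewrite leq_mul2l /=; apply/subset_leq_card/subsetP => n /setIdP[Pn Oxn].
apply/setIdP; split=> //; apply/eqP.
have Gn := subsetP sPG n Pn.
have := bV _ Oxn; rewrite (AutM Ab) // bV ?porbit_id // invMg.
move=> /(canRL (mulKVg _)) ->.
by rewrite conjgE !mulgA mulVg mul1g mulgKV.
Qed.
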